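(* Let $k\ge 1$ and $n_1,\dots,n_k\in\mathbb{Z}$. The group \[ G=\left\langle a,t,b_1,\dots,b_k \;\middle|\; at=ta,\; b_1^{-1}tb_1=a^{n_1}t,\;\dots,\; b_k^{-1}tb_k=a^{n_k}t\right\rangle \] is asynchronously automatic.
   Context: Paths $w,u$ in a Cayley graph (parametrized by arc length, eventually constant) asynchronously $K$-fellow travel if there is a non-decreasing proper continuous function $\phi:[0,\infty)\to[0,\infty)$ with $d(w(s),u(\phi(s)))\le K$ for all $s\ge 0$ (so every point of $w$ is within $K$ of some point of $u$ and vice versa). A group $G$ with finite generating set $A$ is asynchronously automatic if there is a regular language $L$ over $A\cup A^{-1}$ whose evaluation map $L\to G$ is surjective and finite-to-one (no element of $G$ has infinitely many preimages), and a constant $K$ such that whenever $w,u\in L$ and $\overline{u}=\overline{wx}$ for some $x\in A\cup A^{-1}\cup\{1\}$, the paths of $w$ and $u$ in the Cayley graph asynchronously $K$-fellow travel. Such groups are called linearly mismatched free-by-cyclic groups in the paper. *)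

(* Defs.v *)
From HB Require Import structures.
From mathcomp Require Import all_boot all_order all_algebra.
From mathcomp Require Import all_classical all_reals all_analysis.
From mathcomp Require Import Rstruct Rstruct_topology.
Set Implicit Arguments. Unset Strict Implicit. Unset Printing Implicit Defensive.
Import Order.TTheory GRing.Theory Num.Theory.
Local Open Scope classical_set_scope.
Local Open Scope ring_scope.

Notation R := Rdefinitions.R.

Section Presentation.
Variable gen : finType.

(* a letter of A ∪ A^{-1}: (generator, is_inverse) *)
Definition letter := (gen * bool)%type.
Definition word := seq letter.
Definition inv_letter (x : letter) : letter := (x.1, ~~ x.2).

Variable rels : seq word.

Inductive eqG : word -> word -> Prop :=
| eqG_refl w : eqG w w
| eqG_sym w u : eqG w u -> eqG u w
| eqG_trans w u v : eqG w u -> eqG u v -> eqG w v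
| eqG_free u v x : eqG (u ++ x :: inv_letter x :: v) (u ++ v)
| eqG_rel u v r : r \in rels -> eqG (u ++ r ++ v) (u ++ v).

Definition vdist_le (g h : word) (n : nat) : Prop :=
  exists v : word, (size v <= n)%N /\ eqG (g ++ v) h.

(* points of the (geometric) Cayley graph: a vertex, or a point on the edge
   leaving vertex g labelled by the letter x, at distance alpha in [0,1) from g *)
Inductive point := PV of word | PE of word & letter & R.

Definition is_end (P : point) (e : word) (d : R) : Prop :=
  match P with
  | PV g => e = g /\ d = 0
  | PE g x a => (e = g /\ d = a) \/ (e = rcons g x /\ d = 1 - a)
  end.

(* canonical description of an edge point: (base vertex, generator, position
   measured from the base vertex along the edge base --gen--> base*gen) *)
Definition canon (g : word) (x : letter) (a : R) : word * gen * R :=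
  if x.2 then (rcons g x, x.1, 1 - a) else (g, x.1, a).

(* d(P,Q) <= K in the Cayley graph (edges of length 1) *)
Definition close (K : R) (P Q : point) : Prop :=
  (exists g x a h y b,
      P = PE g x a /\ Q = PE h y b /\
      (canon g x a).1.2 = (canon h y b).1.2 /\
      eqG (canon g x a).1.1 (canon h y b).1.1 /\
      `|(canon g x a).2 - (canon h y b).2| <= K)
  \/ (exists e1 d1 e2 d2 (n : nat),
      is_end P e1 d1 /\ is_end Q e2 d2 /\ vdist_le e1 e2 n /\
      d1 + n%:R + d2 <= K).

(* pt_on w s P : P is the point w(s) of the path of w, parametrized by arc
   length and constant after time |w| *)
Definition pt_on (w : word) (s : R) (P : point) : Prop :=
  (exists (i : nat) (x : letter) (rest : word),
      drop i w = x :: rest /\ i%:R <= s /\ s < i.+1%:R /\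
      P = PE (take i w) x (s - i%:R))
  \/ ((size w)%:R <= s /\ P = PV w).

Definition async_fellow_travel (K : R) (w u : word) : Prop :=
  exists phi : R -> R,
    (forall s, 0 <= s -> 0 <= phi s) /\
    (forall s t, 0 <= s -> s <= t -> phi s <= phi t) /\
    {within [set s | 0 <= s], continuous phi} /\
    (forall C : set R, compact C -> compact ([set s | 0 <= s] `&` phi @^-1` C)) /\
    (forall s, 0 <= s -> forall P Q, pt_on w s P -> pt_on u (phi s) Q -> close K P Q).

Record dfa := Dfa {
  dfa_state : finType;
  dfa_start : dfa_state;
  dfa_accept : pred dfa_state;
  dfa_trans : dfa_state -> letter -> dfa_state }.

Definition accepts (D : dfa) (w : word) : bool :=
  @dfa_accept D (foldl (@dfa_trans D) (@dfa_start D) w).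

Definition async_automatic : Prop :=
  exists (D : dfa) (K : R),
    (forall g : word, exists w, accepts D w /\ eqG w g) /\
    (forall g : word, exists s : seq word,
        forall w, accepts D w -> eqG w g -> w \in s) /\
    (forall (w u : word) (x : option letter),
        accepts D w -> accepts D u ->
        eqG u (w ++ (if x is Some y then [:: y] else [::])) ->
        async_fellow_travel K w u).
End Presentation.

(* The group <a, t, b_1..b_k | at=ta, b_i^{-1} t b_i = a^{n_i} t>.
   Generators: 'I_k.+2 with 0 = a, 1 = t, i+2 = b_{i+1}. *)
Definition gen_a (k : nat) : 'I_k.+2 := inord 0.
Definition gen_t (k : nat) : 'I_k.+2 := inord 1.
Definition gen_b (k : nat) (i : 'I_k) : 'I_k.+2 := inord i.+2.

Definition pow_letter (gen : finType) (x : gen) (m : int) : word gen :=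
  match m with
  | Posz p => nseq p (x, false)
  | Negz p => nseq p.+1 (x, true)
  end.

Definition G_rels (k : nat) (n : 'I_k -> int) : seq (word 'I_k.+2) :=
  [:: (gen_a k, false); (gen_t k, false); (gen_a k, true); (gen_t k, true)]
  :: [seq [:: (gen_b i, true); (gen_t k, false); (gen_b i, false); (gen_t k, true)]
            ++ pow_letter (gen_a k) (- n i) | i <- enum 'I_k].

(* Main.v *)
Require Import Defs.
From mathcomp Require Import all_boot all_order all_algebra.
From mathcomp Require Import all_classical all_reals all_analysis.
From mathcomp Require Import Rstruct Rstruct_topology.
From mathcomp Require Import zify ring lra.
From Stdlib Require Import -(notations) Setoid Morphisms.

(* The group is the semidirect product of the free group on [a, b_1, ..., b_k]
   by the infinite cyclic group generated by [t], which fixes [a] and sends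
   [b_i] to [b_i a^(n_i)]. Hence every element is uniquely [t^q v] with [v] a
   reduced word in [a] and the [b_i], and these words form a regular language.
   Right multiplication by [a] or [b_i] changes only the end of the word. Right
   multiplication by [t] turns [t^q v] into [t^(q+1) v'], where [v'] is the
   image of [v] under [b_i -> b_i a^(- n_i)]. For a prefix [p] of [v] with image
   [p'] one has [t^(q+1) p' = t^q p t], so the two paths stay close provided
   that the reduced form of [p'] is close to a prefix of that of [v']. This
   holds because the [b]-letters never cancel and the exponents of the blocks of
   [a]'s change by a bounded amount: [v'] is produced from [v] letter by letter,
   with a bounded power of [a] pending. *)

Set Implicit Arguments.
Unset Strict Implicit.
Unset Printing Implicit Defensive.
Import Order.TTheory GRing.Theory Num.Theory.
Import numFieldNormedType.Exports.
Local Open Scope classical_set_scope.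
Local Open Scope ring_scope.

(** * Piecewise linear interpolation *)

Section Interpolation.
Variable F : realType.
Implicit Types (s t x y : F).

Definition ramp x : F := Num.min (Num.max x 0) 1.

Lemma ramp_homo x y : x <= y -> ramp x <= ramp y.
Proof. by move=> xy; rewrite /ramp le_min2 // le_max2. Qed.

Lemma ramp_ge0 x : 0 <= ramp x.
Proof. by rewrite /ramp le_min le_max lexx orbT ler01. Qed.

Lemma ramp_natB (i j : nat) : ramp (i%:R - j%:R) = (j < i)%N%:R.
Proof.
rewrite /ramp; case: ltnP => ij; last first.
  by rewrite max_r ?min_l // subr_le0 ler_nat.
by rewrite min_r // le_max lerBrDl natr1 ler_nat ij.
Qed.

Lemma ramp_continuous : continuous ramp.
Proof.
move=> x; apply: (@continuous_min _ _ (fun y => Num.max y 0)).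
  by apply: (@continuous_max _ _ id); [exact: cvg_id | exact: cvg_cst].
exact: cvg_cst.
Qed.

Variables (f : nat -> F) (L : nat).

Definition interpolate s : F :=
  f 0 + \sum_(j < L) (f j.+1 - f j) * ramp (s - j%:R) + Num.max (s - L%:R) 0.

Lemma interpolate_continuous : continuous interpolate.
Proof.
have subr_continuous c : continuous (fun s => s - c).
  by move=> s; apply: (@cvgB _ F^o); [exact: cvg_id | exact: cvg_cst].
move=> s; apply: (@cvgD _ F^o); last first.
  by apply: (@continuous_max _ _ (fun s => s - L%:R));
    [exact: subr_continuous | exact: cvg_cst].
apply: (@cvgD _ F^o); first exact: cvg_cst.
apply: cvg_big => [|j _]; first exact: add_continuous.
apply: (@cvgM F); first exact: cvg_cst.
by apply: (@continuous_comp _ _ _ (fun s => s - j%:R) ramp);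
  [exact: subr_continuous | exact: ramp_continuous].
Qed.

Lemma interpolate_nat : (forall i, (L <= i)%N -> f i.+1 = f i + 1) ->
  forall i : nat, interpolate i%:R = f i.
Proof.
move=> f_tail i; rewrite /interpolate.
under eq_bigr do rewrite ramp_natB mulr_natr mulrb.
have [iL|/ltnW Li] := leqP i L.
  rewrite -big_mkcond (big_ord_narrow iL) /=.
  rewrite -(big_mkord xpredT (fun j => f j.+1 - f j)) telescope_sumr //.
  by rewrite max_r ?subr_le0 ?ler_nat // addr0 addrC subrK.
under eq_bigr => j _ do rewrite (leq_trans (ltn_ord j) Li).
rewrite -(big_mkord xpredT (fun j => f j.+1 - f j)) telescope_sumr //.
rewrite max_l ?subr_ge0 ?ler_nat // [f 0 + _]addrC subrK -natrB //.
rewrite -[in RHS](subnKC Li); elim: (i - L)%N => [|m IH].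
  by rewrite addr0 addn0.
by rewrite addnS f_tail ?leq_addr // -IH -natr1 addrA.
Qed.

Hypothesis f_homo : forall i, f i <= f i.+1.

Lemma interpolate_homo s t : s <= t -> interpolate s <= interpolate t.
Proof.
move=> st; apply: lerD; last by rewrite le_max2 // lerB.
rewrite lerD2l ler_sum // => j _.
by rewrite ler_wpM2l ?subr_ge0 // ramp_homo // lerB.
Qed.

Lemma le_interpolate s : 0 <= f 0 -> Num.max (s - L%:R) 0 <= interpolate s.
Proof.
move=> f0; rewrite lerDr addr_ge0 // sumr_ge0 // => j _.
by rewrite mulr_ge0 ?subr_ge0 ?ramp_ge0.
Qed.

End Interpolation.

Lemma compact_preimage_ge_subr (F : realType) (f : F -> F) (c : F) (C : set F) :
  continuous f -> (forall s, s - c <= f s) -> compact C ->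
  compact ([set s | 0 <= s] `&` f @^-1` C).
Proof.
move=> f_cont f_ge cC; have [B [_ C_bounded]] := @compact_bounded F F^o _ cC.
have C_le x : C x -> x <= B + 1.
  by move=> /C_bounded /(le_trans (ler_norm x)); apply; rewrite ltrDl.
apply: (@subclosed_compact _ _ `[0, B + 1 + c]); last 1 first.
- move=> s /= [s0 /C_le fs]; rewrite in_itv /= s0 -lerBlDr.
  exact: le_trans (f_ge s) fs.
- apply: closedI; first exact: closed_ge.
  by apply: preimage_closed; [move=> s _; exact: f_cont
                             | exact: (compact_closed (@Rhausdorff _) cC)].
- exact: segment_compact.
Qed.

Lemma proper_reparametrization (F : realType) (J : nat -> nat) (L : nat) :
  (forall i, (J i <= J i.+1)%N) ->
  (forall i, (L <= i)%N -> J i.+1 = (J i).+1) ->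
  exists phi : F -> F,
    [/\ forall s, 0 <= phi s, {homo phi : s t / s <= t}, continuous phi,
        forall C, compact C -> compact ([set s | 0 <= s] `&` phi @^-1` C)
      & forall i, phi i%:R = (J i)%:R].
Proof.
move=> J_homo J_tail; pose f i : F := (J i)%:R.
have f_homo i : f i <= f i.+1 by rewrite ler_nat.
have interpolate_ge s : Num.max (s - L%:R) 0 <= interpolate f L s.
  exact: le_interpolate.
have interpolate_cont := @interpolate_continuous _ f L.
exists (interpolate f L); split.
- by move=> s; move: (interpolate_ge s); rewrite ge_max => /andP[].
- exact: interpolate_homo.
- exact: interpolate_cont.
- move=> C; apply: (@compact_preimage_ge_subr _ _ L%:R) => // s.
  by move: (interpolate_ge s); rewrite ge_max => /andP[].
- by apply: interpolate_nat => j Lj; rewrite /f J_tail // natr1.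
Qed.

(** * Words in a presented group *)

#[global] Hint Resolve eqG_refl : core.

Section PresentedGroup.
Variables (gen : finType) (rels : seq (word gen)).
Local Notation "u ~~~ v" := (eqG rels u v) (at level 70).
Implicit Types (x : letter gen) (p q u v w g h : word gen).

Lemma inv_letterK : involutive (@inv_letter gen).
Proof. by case=> g s; rewrite /inv_letter /= negbK. Qed.

Lemma eqG_cat2l p u v : u ~~~ v -> p ++ u ~~~ p ++ v.
Proof.
elim=> {u v} [w|w u _ /eqG_sym//|w u v _ + _|u v x|u v r r_rel].
- exact: eqG_refl.
- exact: eqG_trans.
- by rewrite !catA; exact: eqG_free.
- by rewrite (catA p u v) (catA p u); exact: eqG_rel.
Qed.

Lemma eqG_cat2r p u v : u ~~~ v -> u ++ p ~~~ v ++ p.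
Proof.
elim=> {u v} [w|w u _ /eqG_sym//|w u v _ + _|u v x|u v r r_rel].
- exact: eqG_refl.
- exact: eqG_trans.
- by rewrite -!catA; exact: eqG_free.
- by rewrite -!catA; exact: eqG_rel.
Qed.

#[global] Instance eqG_equivalence : Equivalence (eqG rels).
Proof.
by split=> [w|w u|w u v]; [exact: eqG_refl | exact: eqG_sym | exact: eqG_trans].
Qed.

#[global] Instance cat_eqG_morphism :
  Proper (respectful (eqG rels) (respectful (eqG rels) (eqG rels)))
    (@cat (letter gen)).
Proof.
move=> u u' uu' v v' vv'.
exact: eqG_trans (eqG_cat2r v uu') (eqG_cat2l u' vv').
Qed.

#[global] Instance cons_eqG_morphism x :
  Proper (respectful (eqG rels) (eqG rels)) (cons x).
Proof. by move=> u v /(eqG_cat2l [:: x]). Qed.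

Lemma eqG_relator r : r \in rels -> r ~~~ [::].
Proof. by move=> /(eqG_rel [::] [::]); rewrite cats0. Qed.

Lemma eqG_consKV x w : x :: inv_letter x :: w ~~~ w.
Proof. exact: (eqG_free rels [::] w x). Qed.

Lemma eqG_consVK x w : inv_letter x :: x :: w ~~~ w.
Proof. by rewrite -{2}(inv_letterK x); exact: eqG_consKV. Qed.

Definition inv_word p : word gen := rev (map (@inv_letter gen) p).

Lemma size_inv_word p : size (inv_word p) = size p.
Proof. by rewrite size_rev size_map. Qed.

Lemma eqG_catV p : p ++ inv_word p ~~~ [::].
Proof.
elim: p => //= x p IH; rewrite /inv_word /= rev_cons -cats1 catA IH /=.
exact: eqG_consKV.
Qed.

Lemma eqG_catIr p u v : u ++ p ~~~ v ++ p -> u ~~~ v.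
Proof.
by move=> /(eqG_cat2r (inv_word p)); rewrite -!catA eqG_catV !cats0.
Qed.

Lemma eqG_consI x u v : x :: u ~~~ x :: v -> u ~~~ v.
Proof. by move=> /(eqG_cat2l [:: inv_letter x]) /=; rewrite !eqG_consVK. Qed.

Lemma eqG_conjV x p q :
  x :: p ~~~ q ++ [:: x] -> inv_letter x :: q ~~~ p ++ [:: inv_letter x].
Proof.
move=> xp; apply: (@eqG_consI x); rewrite eqG_consKV -cat_cons xp -catA /=.
by rewrite eqG_consKV cats0.
Qed.

Lemma eqG_comm_signs (a b : gen) :
  [:: (a, false); (b, false)] ~~~ [:: (b, false); (a, false)] ->
  forall s s', [:: (a, s); (b, s')] ~~~ [:: (b, s'); (a, s)].
Proof.
move=> ab.
have ab_sign s : [:: (a, s); (b, false)] ~~~ [:: (b, false); (a, s)].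
  by case: s => //; exact: (@eqG_conjV (a, false) [:: _] [:: _]).
move=> s [] //; symmetry; apply: (@eqG_conjV (b, false) [:: _] [:: _]).
exact/eqG_sym/ab_sign.
Qed.

Lemma vdist_le_eqG g h p q (n : nat) : g ++ p ~~~ h ++ q ->
  (size p + size q <= n)%N -> vdist_le rels g h n.
Proof.
move=> gphq pqn; exists (p ++ inv_word q).
rewrite size_cat size_inv_word; split=> //.
by rewrite catA gphq -catA eqG_catV cats0.
Qed.

Lemma vdist_le_refl g n : vdist_le rels g g n.
Proof. exact: (@vdist_le_eqG _ _ [::] [::]). Qed.

Lemma vdist_le_cat g h (n : nat) v m : vdist_le rels g h n -> (size v <= m)%N ->
  vdist_le rels g (h ++ v) (n + m).
Proof.
move=> [p [pn gph]] vm; exists (p ++ v); rewrite size_cat leq_add //.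
by split=> //; rewrite catA gph.
Qed.

End PresentedGroup.

(** * Fellow travelling from blockwise matchings *)

Section FellowTravel.
Variables (gen : finType) (rels : seq (word gen)).
Local Notation "u ~~~ v" := (eqG rels u v) (at level 70).
Implicit Types (x : letter gen) (p q w u v g h : word gen).

Lemma pt_on_is_end w s P : 0 <= s -> pt_on w s P ->
  exists i d, [/\ i%:R <= s < i.+1%:R, d <= 1 & is_end P (take i w) d].
Proof.
move=> s0 [[i [x [r [_ [i_le_s [s_lt_i ->]]]]]] | [ws ->]].
  exists i, (s - i%:R); split; [by rewrite i_le_s | | by left].
  by rewrite lerBlDl natr1 ltW.
exists (Num.truncn s), 0; rewrite truncn_itv // ler01; split => //.
by rewrite take_oversize // truncn_ge_nat.
Qed.

Lemma async_fellow_travel_vertices (J : nat -> nat) (L C M : nat) w u :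
  (forall i, (J i <= J i.+1 <= J i + C)%N) ->
  (forall i, (L <= i)%N -> J i.+1 = (J i).+1) ->
  (forall i, vdist_le rels (take i w) (take (J i) u) M) ->
  async_fellow_travel rels (M + C).+2%:R w u.
Proof.
move=> J_step J_tail J_dist.
have J_homo i : (J i <= J i.+1)%N by case/andP: (J_step i).
have [phi [phi_ge0 phi_homo phi_cont phi_proper phi_nat]] :=
  @proper_reparametrization R J L J_homo J_tail.
exists phi; split=> [//|]; split; first by move=> s t _; exact: phi_homo.
split; first exact: continuous_subspaceT.
split=> [//|].
move=> s s0 P Q /(pt_on_is_end s0) [i [d [/andP[i_le_s s_lt_i] d1 Pend]]].
move=> /(pt_on_is_end (phi_ge0 _)) [j [e [/andP[j_le s_lt_j] e1 Qend]]].
have := phi_homo _ _ i_le_s; rewrite phi_nat => Ji_le.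
have := phi_homo _ _ (ltW s_lt_i); rewrite phi_nat => le_Ji.
have Jij : (J i <= j)%N by rewrite -ltnS -(ltr_nat R) (le_lt_trans Ji_le).
have jJi : (j <= J i.+1)%N by rewrite -(ler_nat R) (le_trans j_le).
right; exists (take i w), d, (take j u), e, (M + C)%N; split=> //; split=> //.
split; last by rewrite -addn2 natrD; lra.
rewrite -(subnKC Jij) takeD; apply: vdist_le_cat => //.
rewrite size_take_min geq_min leq_subLR; apply/orP; left.
by apply: leq_trans jJi _; case/andP: (J_step i).
Qed.

Variables C M : nat.

(* [w], read from the vertex [g], is matched with [u], read from [h]: each
   letter of [w] goes with a block of at most [C] letters of [u], and matched
   vertices are at distance at most [M]. *)
Inductive block_travel : word gen -> word gen -> word gen -> word gen -> Prop :=
| block_travel_nil g h u : vdist_le rels g h M -> (size u <= C)%N ->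
    block_travel g h [::] u
| block_travel_cons g h x w u v : vdist_le rels g h M -> (size u <= C)%N ->
    block_travel (g ++ [:: x]) (h ++ u) w v ->
    block_travel g h (x :: w) (u ++ v).

Definition delayed_block_travel w u :=
  exists u0 u1, u = u0 ++ u1 /\ block_travel [::] u0 w u1.

Hypothesis C_gt0 : (0 < C)%N.

Lemma block_travel_vertices g h w u : block_travel g h w u ->
  exists J : nat -> nat,
    [/\ J 0 = 0, forall i, (J i <= J i.+1 <= J i + C)%N,
        forall i, (size w <= i)%N -> J i.+1 = (J i).+1 &
        forall i, vdist_le rels (g ++ take i w) (h ++ take (J i) u) (M + C)]%N.
Proof.
elim=> {g h w u} [g h u gh uC | g h x w u v gh uC _].
  exists id; split=> // [i|i]; first by rewrite leqnSn -addn1 leq_add2l.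
  rewrite cats0; apply: vdist_le_cat => //.
  by rewrite size_take_min geq_min uC orbT.
case=> J [J0 J_step J_tail J_dist].
exists (fun i => if i is i'.+1 then size u + J i' else 0)%N; split=> //.
- by case=> [|i]; rewrite ?J0 ?addn0 // -addnA !leq_add2l.
- by case=> // i iw; rewrite J_tail // addnS.
case=> [|i]; first by rewrite !take0 !cats0 -[h]cats0; apply: vdist_le_cat.
by rewrite take_cat ltnNge leq_addr /= addKn -cat1s !catA.
Qed.

Lemma async_fellow_travel_block w u :
  delayed_block_travel w u -> async_fellow_travel rels (M + C + C).+2%:R w u.
Proof.
move=> [u0 [u1 [-> /block_travel_vertices[J [_ J_step J_tail J_dist]]]]].
apply: (@async_fellow_travel_vertices (fun i => size u0 + J i)%N (size w)).
- by move=> i; rewrite -addnA !leq_add2l.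
- by move=> i iw; rewrite J_tail // addnS.
by move=> i; rewrite take_cat ltnNge leq_addr /= addKn; exact: J_dist.
Qed.

Lemma block_travel_cat c p g h w u :
  (size c <= M)%N -> {in p, forall x, x :: c ~~~ c ++ [:: x]} -> g ++ c ~~~ h ->
  block_travel (g ++ p) (h ++ p) w u -> block_travel g h (p ++ w) (p ++ u).
Proof.
move=> cM; elim: p g h => [|x p IH] g h; first by rewrite !cats0.
move=> /= cp gch; rewrite -[x :: p]cat1s !catA => wu.
apply: (block_travel_cons (u := [:: x])) => //.
  by apply: (vdist_le_eqG (p := c) (q := [::])); rewrite ?cats0 ?addn0.
apply: IH wu => [y yp|]; first by apply: cp; rewrite inE yp orbT.
by rewrite -catA /= cp ?mem_head // catA gch.
Qed.

Lemma block_travel_common_prefix p w u :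
  block_travel p p w u -> block_travel [::] [::] (p ++ w) (p ++ u).
Proof. by move=> ?; apply: (@block_travel_cat [::]). Qed.

Lemma delayed_block_travel_refl w : delayed_block_travel w w.
Proof.
exists [::], w; split=> //; rewrite -[w]cats0.
apply/block_travel_common_prefix/block_travel_nil => //.
exact: vdist_le_refl.
Qed.

Lemma delayed_block_travel_rcons w x : delayed_block_travel w (rcons w x).
Proof.
exists [::], (rcons w x); split=> //; rewrite -cats1 -{1}[w]cats0.
apply/block_travel_common_prefix/block_travel_nil => //.
exact: vdist_le_refl.
Qed.

Lemma delayed_block_travel_unrcons w x :
  (0 < M)%N -> delayed_block_travel (rcons w x) w.
Proof.
move=> M_gt0; exists [::], w; split=> //; rewrite -cats1 -{2}[w]cats0.
apply: block_travel_common_prefix.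
apply: (block_travel_cons (u := [::]) (v := [::])) => //.
  exact: vdist_le_refl.
apply: block_travel_nil => //.
apply: (vdist_le_eqG (p := [::]) (q := [:: x])) => //.
by rewrite !cats0.
Qed.

End FellowTravel.

(** * Free reduction *)

Lemma int_sign_ind (P : int -> Prop) : P 0 ->
  (forall z (s : bool), 0 <= (-1) ^+ s * z -> P z -> P (z + (-1) ^+ s)) ->
  forall z, P z.
Proof.
move=> P0 PS; elim/int_ind=> // m Pm; rewrite -addn1 PoszD ?opprD.
  by apply: (PS _ false) => //; rewrite mul1r.
by apply: (PS _ true) => //; rewrite expr1 mulN1r opprK.
Qed.

Section FreeReduction.
Variable gen : finType.
Implicit Types (x y : letter gen) (v w p : word gen) (z : int) (g : gen).

Lemma pow_letterS g z (s : bool) : 0 <= (-1) ^+ s * z ->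
  pow_letter g (z + (-1) ^+ s) = (g, s) :: pow_letter g z.
Proof.
case: s z => [] [] m //=; rewrite ?expr1 ?expr0 ?mulN1r ?mul1r //.
- by case: m.
- by rewrite /= addn0.
- by rewrite /= addn1.
Qed.

Lemma pow_letter_step g z (s : bool) :
  pow_letter g (z + (-1) ^+ s) = (g, s) :: pow_letter g z \/
  pow_letter g z = (g, ~~ s) :: pow_letter g (z + (-1) ^+ s).
Proof.
have [sz|sz] := lerP 0 ((-1) ^+ s * z); first by left; exact: pow_letterS.
right; rewrite -pow_letterS; first by rewrite signrN addrK.
by case: s sz => /=; lia.
Qed.

Lemma size_pow_letter g z : size (pow_letter g z) = `|z|%N.
Proof. by case: z => m /=; rewrite size_nseq. Qed.

Lemma mem_pow_letter g z x : x \in pow_letter g z -> x.1 = g.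
Proof. by case: z => m; rewrite mem_nseq => /andP[_ /eqP->]. Qed.

Lemma pow_letter_cat_head g z y v w :
  y.1 != g -> pow_letter g z ++ v = y :: w -> z = 0 /\ v = y :: w.
Proof.
by move=> y_g; case: z => [[|m]|m] //= [y_eq]; rewrite -y_eq eqxx in y_g.
Qed.

Definition noncancelling : rel (letter gen) := fun x y => y != inv_letter x.
Definition reduced := sorted noncancelling.

Lemma reduced_pow_letter_sign g s z v :
  reduced ((g, s) :: pow_letter g z ++ v) -> 0 <= (-1) ^+ s * z.
Proof.
by case: s z => [] [[|m]|m] //=; rewrite /noncancelling /inv_letter /= ?eqxx.
Qed.

Lemma reduced_pow_letter_cat g z v :
  reduced v -> (if v is y :: _ then y.1 != g else true) ->
  reduced (pow_letter g z ++ v).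
Proof.
move=> v_red v_g; elim/int_sign_ind: z => [|z s sz IH] //.
rewrite pow_letterS //; move: IH; rewrite /reduced /=.
case cat_eq : (pow_letter g z ++ v) => [|y p] //= ->; rewrite andbT.
case: z sz cat_eq => [[|m]|m] /= sz cat_eq.
  by move: v_g; rewrite cat_eq; apply: contraNneq => ->.
all: case: cat_eq sz => <- _.
all: by case: s; rewrite /noncancelling /inv_letter xpair_eqE eqxx.
Qed.

Definition letter_mul x v :=
  if v is y :: v' then if y == inv_letter x then v' else x :: v else [:: x].

Definition word_mul p v := foldr letter_mul v p.

Lemma reduced_letter_mul x v : reduced v -> reduced (letter_mul x v).
Proof.
case: v => [|y v] //= yv; case: ifP => [_|/negbT yx].
  exact: path_sorted yv.
by rewrite /reduced /= yv andbT.
Qed.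

Lemma reduced_word_mul p v : reduced v -> reduced (word_mul p v).
Proof. by move=> v_red; elim: p => //= x p; exact: reduced_letter_mul. Qed.

Lemma letter_mul_reduced x v : reduced (x :: v) -> letter_mul x v = x :: v.
Proof. by case: v => [|y v] //= /andP[/negbTE -> _]. Qed.

Lemma letter_mulKV x v :
  reduced v -> letter_mul x (letter_mul (inv_letter x) v) = v.
Proof.
case: v => [|y v] /=; first by rewrite eqxx.
rewrite inv_letterK; case: eqP => [-> /letter_mul_reduced //|_ _].
by rewrite /= eqxx.
Qed.

Lemma letter_mul_pow_letter g s z v : reduced v ->
  letter_mul (g, s) (word_mul (pow_letter g z) v) =
  word_mul (pow_letter g (z + (-1) ^+ s)) v.
Proof.
move=> v_red; have [->//|->] := pow_letter_step g z s.
exact/letter_mulKV/reduced_word_mul.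
Qed.

Lemma word_mul_pow_letterD g z z' v : reduced v ->
  word_mul (pow_letter g z) (word_mul (pow_letter g z') v) =
  word_mul (pow_letter g (z + z')) v.
Proof.
move=> v_red; elim/int_sign_ind: z => [|z s sz IH]; first by rewrite add0r.
by rewrite pow_letterS //= IH letter_mul_pow_letter // addrAC.
Qed.

Variable rels : seq (word gen).
Local Notation "u ~~~ v" := (eqG rels u v) (at level 70).

Lemma eqG_cons_pow_letter g s z w :
  (g, s) :: pow_letter g z ++ w ~~~ pow_letter g (z + (-1) ^+ s) ++ w.
Proof. by have [->//|->] := pow_letter_step g z s; exact: eqG_consKV. Qed.

Lemma eqG_pow_letterD g z z' w :
  pow_letter g z ++ pow_letter g z' ++ w ~~~ pow_letter g (z + z') ++ w.
Proof.
elim/int_sign_ind: z => [|z s sz IH]; first by rewrite add0r.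
by rewrite pow_letterS //= IH addrAC; exact: eqG_cons_pow_letter.
Qed.

Lemma eqG_pow_letter_rcons g z (s : bool) :
  pow_letter g z ++ [:: (g, s)] ~~~ pow_letter g (z + (-1) ^+ s).
Proof.
have := eqG_pow_letterD g z ((-1) ^+ s) [::]; rewrite !cats0.
by case: s.
Qed.

Lemma eqG_pow_letter_comm g x z w :
  (forall s, [:: (g, s); x] ~~~ [:: x; (g, s)]) ->
  pow_letter g z ++ x :: w ~~~ x :: pow_letter g z ++ w.
Proof.
move=> gx; elim/int_sign_ind: z => [|z s sz IH] //.
by rewrite pow_letterS //= IH; exact: (eqG_cat2r (pow_letter g z ++ w) (gx s)).
Qed.

End FreeReduction.

(** * Moving [t] through a word *)

Section LinearlyMismatched.
Variables (k : nat) (n : 'I_k -> int).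
Local Notation gen := 'I_k.+2.
Local Notation a := (gen_a k).
Local Notation t := (gen_t k).
Local Notation "u ~~~ v" := (eqG (G_rels n) u v) (at level 70).
Implicit Types (x y : letter gen) (u v w g h : word gen) (d z : int) (s : bool).

Lemma gen_a_neq_t : a != t.
Proof. by rewrite -val_eqE /= !inordK. Qed.

Lemma val_gen_b (i : 'I_k) : val (gen_b i) = i.+2.
Proof. by rewrite /= inordK // !ltnS. Qed.

Lemma gen_b_neq_a i : gen_b i != a.
Proof. by rewrite -val_eqE val_gen_b /= inordK. Qed.

Lemma gen_b_neq_t i : gen_b i != t.
Proof. by rewrite -val_eqE val_gen_b /= inordK. Qed.

Lemma gen_b_inj : injective (@gen_b k).
Proof. by move=> i j /(congr1 val); rewrite !val_gen_b => -[] /val_inj. Qed.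

Lemma gen_bP (c : gen) : c != a -> c != t -> exists i, c = gen_b i.
Proof.
case: c => -[|[|m]] ltm; rewrite -!val_eqE /= !inordK // => _ _.
by exists (Ordinal (ltm : (m < k)%N)); apply: val_inj; rewrite val_gen_b.
Qed.

Definition expo (c : gen) : int := \sum_(i | gen_b i == c) n i.

Lemma expo_b i : expo (gen_b i) = n i.
Proof.
by rewrite /expo (big_pred1 i) // => j; rewrite (inj_eq gen_b_inj).
Qed.

Lemma expo_a : expo a = 0.
Proof. by rewrite /expo big_pred0 // => i; exact/negbTE/gen_b_neq_a. Qed.

Lemma eqG_at s s' : [:: (a, s); (t, s')] ~~~ [:: (t, s'); (a, s)].
Proof.
apply: eqG_comm_signs; apply: (@eqG_catIr _ _ [:: (a, true); (t, true)]).
rewrite (eqG_catV _ [:: (t, false); (a, false)]).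
by apply: eqG_relator; rewrite inE eqxx.
Qed.

Lemma eqG_pow_a_t d s w :
  pow_letter a d ++ (t, s) :: w ~~~ (t, s) :: pow_letter a d ++ w.
Proof. by apply: eqG_pow_letter_comm => s'; exact: eqG_at. Qed.

Lemma eqG_bt i s : [:: (gen_b i, false); (t, s)] ~~~
  (t, s) :: (gen_b i, false) :: pow_letter a (- ((-1) ^+ s * n i)).
Proof.
have bt : [:: (gen_b i, false); (t, false)] ~~~
    (t, false) :: (gen_b i, false) :: pow_letter a (- n i).
  apply: (@eqG_consI _ _ (gen_b i, true)).
  rewrite (eqG_consVK _ (gen_b i, false)).
  apply: (@eqG_catIr _ _ [:: (t, true)]) => /=.
  rewrite (eqG_consKV _ (t, false)) eqG_pow_a_t.
  rewrite cats0; symmetry; apply: eqG_relator; rewrite inE; apply/orP; right.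
  by apply/mapP; exists i; rewrite ?mem_enum.
case: s; last by rewrite mul1r.
rewrite expr1 mulN1r opprK; symmetry.
have tb : (t, true) :: [:: (gen_b i, false)] ~~~
    ((gen_b i, false) :: pow_letter a (- n i)) ++ [:: (t, true)].
  by apply: (@eqG_conjV _ _ (t, false)); symmetry.
apply: eqG_trans (eqG_cat2r (pow_letter a (n i)) tb) _; rewrite -catA /=.
by rewrite eqG_pow_a_t -[pow_letter a (n i)]cats0 eqG_pow_letterD addNr.
Qed.

(* Here and below [t^s] stands for [t^-1] if [s] is true and for [t] if not. For
   a letter [x] other than [t] and [t^-1] the exponents are chosen such that
   [x t^s = t^s a^(shift s x) x a^(- shift s x^-1)]. *)
Definition shift s x : int := if x.2 then (-1) ^+ s * expo x.1 else 0.

Lemma eqG_letter_t s x : x.1 != t -> [:: x; (t, s)] ~~~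
  (t, s) :: pow_letter a (shift s x) ++
    x :: pow_letter a (- shift s (inv_letter x)).
Proof.
case: x => c s' /= c_t; rewrite /shift /=.
have [->|c_a] := eqVneq c a.
  by rewrite expo_a mulr0 !if_same oppr0; exact: eqG_at.
have [i ->] := gen_bP c_a c_t; rewrite expo_b.
case: s' => /=; last exact: eqG_bt.
apply: (@eqG_conjV _ _ (gen_b i, false) (_ :: _) (_ :: _)).
apply: eqG_trans (eqG_cat2r (pow_letter a _) (eqG_bt i s)) _ => /=.
by rewrite -[X in _ ++ X]cats0 eqG_pow_letterD addNr.
Qed.

Lemma shift_a s s' : shift s (a, s') = 0.
Proof. by rewrite /shift expo_a mulr0 if_same. Qed.

Definition t_free w := all (fun x => x.1 != t) w.

Lemma t_free_pow_a d : t_free (pow_letter a d).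
Proof. by apply/allP => x /mem_pow_letter ->; exact: gen_a_neq_t. Qed.

(* The reduced form of [a^d v'], where [v t^s = t^s v']: a power of [a] is
   pending, and it is written down only in front of a [b]-letter or at the
   end. *)
Fixpoint twist s d v : word gen :=
  if v is x :: v' then
    if x.1 == a then twist s (d + (-1) ^+ x.2) v'
    else pow_letter a (d + shift s x) ++
         x :: twist s (- shift s (inv_letter x)) v'
  else pow_letter a d.

Lemma eqG_pending_letter s d x g h : x.1 != t ->
  g ++ [:: (t, s)] ~~~ h ++ pow_letter a d ->
  (g ++ [:: x]) ++ [:: (t, s)] ~~~
  (h ++ pow_letter a (d + shift s x) ++ [:: x]) ++
    pow_letter a (- shift s (inv_letter x)).
Proof.
move=> x_t gh; rewrite -catA /= (eqG_letter_t s x_t) -cat1s catA gh -!catA.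
by rewrite eqG_pow_letterD.
Qed.

Lemma eqG_pending_a s d s' g h :
  g ++ [:: (t, s)] ~~~ h ++ pow_letter a d ->
  (g ++ [:: (a, s')]) ++ [:: (t, s)] ~~~ h ++ pow_letter a (d + (-1) ^+ s').
Proof.
move=> /(eqG_pending_letter (x := (a, s')) gen_a_neq_t).
by rewrite !shift_a oppr0 addr0 cats0 eqG_pow_letter_rcons.
Qed.

Lemma eqG_twist s d v g h : t_free v ->
  g ++ [:: (t, s)] ~~~ h ++ pow_letter a d ->
  g ++ v ++ [:: (t, s)] ~~~ h ++ twist s d v.
Proof.
elim: v d g h => [|[c s'] v IH] d g h //= /andP[c_t v_t] gh.
rewrite -cat_rcons -cats1.
case: eqP => [->|_]; first exact: (IH _ _ _ v_t (eqG_pending_a _ gh)).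
rewrite (IH _ _ _ v_t (eqG_pending_letter (x := (c, s')) c_t gh)).
by rewrite -!catA.
Qed.

Lemma t_free_twist s d v : t_free v -> t_free (twist s d v).
Proof.
elim: v d => [|x v IH] d /=; first by move=> _; exact: t_free_pow_a.
move=> /andP[x_t v_t]; case: ifP => _; first exact: IH.
rewrite /t_free all_cat /= x_t; apply/andP.
by split; [exact: t_free_pow_a | exact: IH].
Qed.

Lemma twist_head s d v y u : y.1 != a -> reduced v -> twist s d v = y :: u ->
  exists z v', v = pow_letter a z ++ y :: v' /\ d + z + shift s y = 0.
Proof.
move=> y_a; elim: v d => [|[c s'] v IH] d /=.
  by move=> _; rewrite -[pow_letter a d]cats0 => /(pow_letter_cat_head y_a)[].
case: eqP => [-> | c_a] xv.
  move=> /(IH _ (path_sorted xv)) [z [v' [v_eq dz]]].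
  exists (z + (-1) ^+ s'), v'; split; last by rewrite -dz; ring.
  by rewrite v_eq in xv *; rewrite pow_letterS // (reduced_pow_letter_sign xv).
by move=> /(pow_letter_cat_head y_a)[d0 [<- _]]; exists 0, v; rewrite addr0.
Qed.

(* No new cancellation: the shifts inside [x a^z x^-1] are opposite, so its
   image again has [a^z] between [x] and [x^-1]. *)
Lemma reduced_twist s d v : reduced v -> reduced (twist s d v).
Proof.
elim: v d => [|x v IH] d /=.
  by move=> _; rewrite -[pow_letter _ _]cats0; exact: reduced_pow_letter_cat.
move=> xv; have v_red := path_sorted xv.
case: eqP => [_|/eqP x_a]; first exact: IH.
apply: reduced_pow_letter_cat => //.
move: (IH (- shift s (inv_letter x)) v_red); rewrite /reduced /=.
case twist_eq : (twist _ _ _) => [|y u] //= ->; rewrite andbT.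
apply/eqP => y_eq; have y_a : y.1 != a by rewrite y_eq.
have [z [v' [v_eq]]] := twist_head y_a v_red twist_eq.
rewrite -y_eq addrAC addNr add0r => z0.
by move: xv; rewrite v_eq z0 /= y_eq /noncancelling eqxx.
Qed.

(* Once the pending exponent exceeds every shift, further letters [a^s] are
   written down immediately. *)
Lemma twist_saturated (N : nat) s s' d v : (forall x, `|shift s x| <= N%:Z) ->
  reduced ((a, s') :: v) -> N%:Z <= (-1) ^+ s' * d ->
  twist s (d + (-1) ^+ s') v = (a, s') :: twist s d v.
Proof.
move=> shift_le; elim: v d => [|[c s''] v IH] d /=.
  by move=> _ Nd; rewrite pow_letterS //; exact: le_trans Nd.
move=> /andP[nc xv] Nd; case: eqP => c_a.
  have s''_eq : s'' = s'.
    move: nc; rewrite c_a /noncancelling xpair_eqE eqxx.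
    by case: (s') (s'') => -[].
  rewrite c_a s''_eq in xv *; apply: IH => //.
  by case: (s') Nd => /=; lia.
rewrite addrAC pow_letterS //.
by have := shift_le (c, s''); case: (s') Nd => /=; lia.
Qed.

(** * Normal forms and their paths *)

Definition max_expo : nat := \max_(c : gen) `|expo c|%N.

Lemma shift_le s x : `|shift s x| <= max_expo%:Z.
Proof.
have : (`|expo x.1| <= max_expo)%N.
  exact: (@leq_bigmax _ (fun c => absz (expo c))).
by rewrite /shift; case: (x.2); case: s => /=; lia.
Qed.

Local Notation block_size := (max_expo + max_expo).+1.
Local Notation travel := (block_travel (G_rels n) block_size max_expo.+1).
Local Notation delayed_travel :=
  (delayed_block_travel (G_rels n) block_size max_expo.+1).

Lemma block_travel_twist s d v g h :
  reduced v -> t_free v -> `|d| <= max_expo%:Z ->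
  g ++ [:: (t, s)] ~~~ h ++ pow_letter a d -> travel g h v (twist s d v).
Proof.
elim: v d g h => [|[c s'] v IH] d g h xv v_t d_le gh.
all: have gh_dist : vdist_le (G_rels n) g h max_expo.+1
  by apply: (vdist_le_eqG gh); rewrite size_pow_letter /=; lia.
  by apply: block_travel_nil => //; rewrite size_pow_letter; lia.
have v_red : reduced v := path_sorted xv.
move: v_t => /= /andP[c_t v_t]; case: eqP => [c_a|_]; last first.
  rewrite -cat_rcons; apply: block_travel_cons => //.
    rewrite size_rcons size_pow_letter ltnS -lez_nat abszE PoszD.
    exact: le_trans (ler_normD _ _) (lerD d_le (shift_le _ _)).
  apply: IH => //; first by rewrite normrN; exact: shift_le.
  by rewrite -cats1; exact: eqG_pending_letter.
rewrite c_a in xv *; have gh' := eqG_pending_a s' gh.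
have [d'_le|d'_gt] := lerP `|d + (-1) ^+ s'| max_expo%:Z.
  by apply: (block_travel_cons (u := [::])) => //; apply: IH; rewrite ?cats0.
rewrite (twist_saturated (shift_le s)) //; last by case: (s') d'_gt => /=; lia.
apply: (block_travel_cons (u := [:: (a, s')])) => //; apply: IH => //.
by rewrite gh' -catA /= -[pow_letter a d]cats0 eqG_cons_pow_letter cats0.
Qed.

Lemma block_travel_mul_t s z v g h : reduced v -> t_free v ->
  g ++ [:: (t, s)] ~~~ h ->
  travel g h (pow_letter t z ++ v) (pow_letter t z ++ twist s 0 v).
Proof.
move=> v_red v_t gh.
have t_comm s' : [:: (t, s'); (t, s)] ~~~ [:: (t, s); (t, s')].
  exact: eqG_comm_signs.
apply: (block_travel_cat _ (c := [:: (t, s)])) => //.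
  by move=> [c s'] /mem_pow_letter /= ->.
apply: block_travel_twist => //; rewrite cats0 -gh -!catA.
by rewrite (eqG_pow_letter_comm z [::] t_comm) cats0.
Qed.

Definition t_first : rel (letter gen) := fun x y => (y.1 == t) ==> (x.1 == t).
Definition normal_form w := reduced w && sorted t_first w.

Lemma normal_form_cat z v :
  t_free v -> reduced v -> normal_form (pow_letter t z ++ v).
Proof.
move=> v_t v_red; apply/andP; split.
  by apply: reduced_pow_letter_cat => //; case: (v) v_t => //= y ? /andP[].
elim/int_sign_ind: z => [|z s sz IH]; last first.
  rewrite pow_letterS //= path_min_sorted //.
  by apply/allP => x; rewrite /t_first eqxx implybT.
elim: v v_t {v_red} => //= x v IH /andP[_ v_t].
rewrite path_min_sorted ?IH //; apply: sub_all v_t => y.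
by rewrite /t_first => /negbTE ->.
Qed.

Lemma normal_formP w : normal_form w ->
  exists z v, [/\ w = pow_letter t z ++ v, t_free v & reduced v].
Proof.
elim: w => [|[c s] w IH]; first by exists 0, [::].
move=> /andP[xw x_first].
have [|z [v [w_eq v_t v_red]]] := IH.
  by rewrite /normal_form /reduced (path_sorted xw) (path_sorted x_first).
have [c_t|c_t] := eqVneq c t.
  exists (z + (-1) ^+ s), v; split=> //; rewrite w_eq c_t in xw *.
  by rewrite pow_letterS // (reduced_pow_letter_sign xw).
exists 0, ((c, s) :: v); rewrite /t_free /= c_t.
suff z0 : z = 0 by rewrite w_eq z0 in xw *.
by move: x_first; rewrite w_eq; case: z {w_eq} => [[]|] //= m;
  rewrite /t_first eqxx (negbTE c_t).
Qed.

Lemma normal_form_mul_t w s : normal_form w ->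
  exists u, [/\ normal_form u, u ~~~ w ++ [:: (t, s)] & delayed_travel w u].
Proof.
move=> /normal_formP[z [v [-> v_t v_red]]].
exists (pow_letter t (z + (-1) ^+ s) ++ twist s 0 v); split.
- by apply: normal_form_cat; [exact: t_free_twist | exact: reduced_twist].
- rewrite -catA; symmetry; apply: eqG_twist => //.
  by rewrite cats0; exact: eqG_pow_letter_rcons.
have [->|z_eq] := pow_letter_step t z s.
  exists [:: (t, s)], (pow_letter t z ++ twist s 0 v); split=> //.
  exact: block_travel_mul_t.
exists [::], (pow_letter t (z + (-1) ^+ s) ++ twist s 0 v); split=> //.
rewrite z_eq; apply: (block_travel_cons (u := [::])) => //.
  exact: vdist_le_refl.
apply: block_travel_mul_t => //=.
by rewrite -{2}[s]negbK; exact: (eqG_consKV _ (t, ~~ s)).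
Qed.

Lemma normal_form_mul_t_free w y : y.1 != t -> normal_form w ->
  exists u, [/\ normal_form u, u ~~~ w ++ [:: y] & delayed_travel w u].
Proof.
move=> y_t; case/lastP: w => [|w x] w_nf.
  exists [:: y]; split=> //.
  exact: (@delayed_block_travel_rcons _ _ _ _ _ [::]).
have [y_eq|y_neq] := eqVneq y (inv_letter x).
  exists w; split; last exact: delayed_block_travel_unrcons.
    move: w_nf; rewrite /normal_form /reduced -cats1.
    by move=> /andP[/cat_sorted2[-> _] /cat_sorted2[-> _]].
  by rewrite y_eq -cats1 -catA /= eqG_consKV cats0.
exists (rcons (rcons w x) y); split; last exact: delayed_block_travel_rcons.
  move: w_nf; rewrite /normal_form /reduced -[rcons _ y]cats1 cat_rcons.
  rewrite !sorted_cat_cons => /andP[-> ->].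
  by rewrite /= /noncancelling y_neq /t_first (negbTE y_t).
by rewrite -[rcons _ y]cats1.
Qed.

Lemma normal_form_mul w y : normal_form w ->
  exists u, [/\ normal_form u, u ~~~ w ++ [:: y] & delayed_travel w u].
Proof.
case: y => c s; have [->|] := eqVneq c t; first exact: normal_form_mul_t.
exact: (@normal_form_mul_t_free w (c, s)).
Qed.

Lemma normal_form_exists w : exists u, normal_form u /\ u ~~~ w.
Proof.
elim/last_ind: w => [|w x [u [u_nf uw]]]; first by exists [::].
have [u' [u'_nf u'_eq _]] := normal_form_mul x u_nf.
by exists u'; split=> //; rewrite u'_eq -cats1 uw.
Qed.

(** * Uniqueness of normal forms *)

(* Left multiplication by [x] on the elements [t^q v], with [v] reduced:
   [b t^q v = t^q b a^(- q n_b) v]. *)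
Definition act x (qv : int * word gen) : int * word gen :=
  let: (q, v) := qv in
  if x.1 == t then (q + (-1) ^+ x.2, v)
  else (q, let z := q * expo x.1 in
           if x.2 then word_mul (pow_letter a z) (letter_mul x v)
           else letter_mul x (word_mul (pow_letter a (- z)) v)).

Definition act_word w qv := foldr act qv w.

Lemma reduced_act_word w qv : reduced qv.2 -> reduced (act_word w qv).2.
Proof.
move=> v_red; elim: w => //= x w.
rewrite /act; case: (act_word w qv) => q v /= v_red'.
case: ifP => //= _; case: ifP => _.
  exact/reduced_word_mul/reduced_letter_mul.
exact/reduced_letter_mul/reduced_word_mul.
Qed.

Lemma actKV x qv : reduced qv.2 -> act x (act (inv_letter x) qv) = qv.
Proof.
case: x qv => c s [q v] /= v_red; rewrite /act /=; case: (c == t).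
  by rewrite signrN addrNK.
congr (_, _); case: s => /=.
  rewrite (letter_mulKV (c, true)) ?reduced_word_mul //.
  by rewrite word_mul_pow_letterD // subrr.
rewrite word_mul_pow_letterD ?reduced_letter_mul // addNr.
exact: (letter_mulKV (c, false)).
Qed.

Lemma act_word_pow_a z q v :
  act_word (pow_letter a z) (q, v) = (q, word_mul (pow_letter a z) v).
Proof.
elim/int_sign_ind: z => [|z s sz IH] //.
rewrite pow_letterS //= IH /act /= (negbTE gen_a_neq_t) expo_a mulr0 oppr0.
by case: (s).
Qed.

Lemma act_word_relator r qv :
  r \in G_rels n -> reduced qv.2 -> act_word r qv = qv.
Proof.
case: qv => q v /= + v_red; rewrite inE => /orP[/eqP ->|/mapP[i _ ->]].
  rewrite /act_word /= /act /= eqxx (negbTE gen_a_neq_t) expo_a !mulr0 oppr0 /=.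
  by rewrite (letter_mulKV (a, false)) // expr1 expr0 addrNK.
rewrite /act_word foldr_cat -!/(act_word _ _) act_word_pow_a /= /act /= eqxx.
rewrite (negbTE (gen_b_neq_t i)) /= expo_b word_mul_pow_letterD //.
rewrite (letter_mulKV (gen_b i, true)) ?reduced_word_mul //.
rewrite word_mul_pow_letterD // expr1 expr0.
by rewrite addrNK (_ : _ + _ = 0) //; ring.
Qed.

Lemma act_word_eqG w u qv :
  w ~~~ u -> reduced qv.2 -> act_word w qv = act_word u qv.
Proof.
move=> wu v_red; elim: wu => {w u} //.
- by move=> w u v _ -> _ ->.
- move=> u v x; rewrite /act_word !foldr_cat /= actKV //.
  exact: reduced_act_word.
- move=> u v r r_rel; rewrite /act_word !foldr_cat; congr foldr.
  exact/act_word_relator/reduced_act_word.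
Qed.

Lemma act_word_normal_form z v : t_free v -> reduced v ->
  act_word (pow_letter t z ++ v) (0, [::]) = (z, v).
Proof.
move=> v_t v_red; rewrite /act_word foldr_cat.
have -> : foldr act (0, [::]) v = (0, v).
  elim: v v_t v_red => //= x v IH /andP[x_t v_t] xv.
  rewrite IH //; last exact: path_sorted xv.
  rewrite /act (negbTE x_t) mul0r oppr0 /= letter_mul_reduced //.
  by case: (x.2).
elim/int_sign_ind: z => [|z s sz IH] //.
by rewrite pow_letterS //= IH /act eqxx.
Qed.

Lemma normal_form_inj w u : normal_form w -> normal_form u -> w ~~~ u -> w = u.
Proof.
move=> /normal_formP[z [v [-> v_t v_red]]].
move=> /normal_formP[z' [v' [-> v'_t v'_red]]].
move=> /(@act_word_eqG _ _ (0, [::])) /(_ isT).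
by rewrite !act_word_normal_form // => -[-> ->].
Qed.

Lemma normal_form_delayed_travel w u (x : option (letter gen)) :
  normal_form w -> normal_form u ->
  u ~~~ w ++ (if x is Some y then [:: y] else [::]) -> delayed_travel w u.
Proof.
move=> w_nf u_nf; case: x => [y|] uw.
  have [u' [u'_nf u'w wu']] := normal_form_mul y w_nf.
  by rewrite (normal_form_inj u_nf u'_nf) // uw u'w.
rewrite cats0 in uw; rewrite (normal_form_inj u_nf w_nf uw).
exact: delayed_block_travel_refl.
Qed.

Lemma normal_forms_fellow_travel : exists K : R,
  forall w u (x : option (letter gen)), normal_form w -> normal_form u ->
  u ~~~ w ++ (if x is Some y then [:: y] else [::]) ->
  async_fellow_travel (G_rels n) K w u.
Proof.
exists (max_expo.+1 + block_size + block_size).+2%:R => w u x w_nf u_nf uw.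
apply: async_fellow_travel_block => //.
exact: normal_form_delayed_travel uw.
Qed.

End LinearlyMismatched.

Lemma sorted_dfa (gen : finType) (r : rel (letter gen)) :
  exists D : dfa gen, accepts D =1 sorted r.
Proof.
pose trans (st : option (option (letter gen))) x := match st with
  | None => None
  | Some None => Some (Some x)
  | Some (Some y) => if r y x then Some (Some x) else None
  end.
exists (@Dfa gen (option (option (letter gen))) (Some None) isSome trans).
case=> //= x w; rewrite /accepts /=.
elim: w x => //= y w IH x; case: ifP => // _.
by elim: w {IH}.
Qed.

Theorem mainTheorem1 (k : nat) (n : 'I_k -> int) (hk : (1 <= k)%N) :
  async_automatic (G_rels n).
Proof.
have [D D_sorted] :=
  sorted_dfa [rel x y | @noncancelling 'I_k.+2 x y && @t_first k x y].
have acceptsE w : accepts D w = normal_form w by rewrite D_sorted sorted_relI.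
have [K K_travel] := normal_forms_fellow_travel n.
exists D, K; split=> [g|].
  have [w [w_nf wg]] := normal_form_exists n g.
  by exists w; rewrite acceptsE.
split=> [g|w u x].
  have [u [u_nf ug]] := normal_form_exists n g; exists [:: u] => w.
  rewrite acceptsE inE => w_nf wg; apply/eqP/(normal_form_inj w_nf u_nf).
  by rewrite wg ug.
by rewrite !acceptsE; exact: K_travel.
Qed.
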